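(* Let $S$ be a $\mathrm{Cu}$-semigroup. Then the collection of sub-$\mathrm{Cu}$-semigroups of $S$ is a complete lattice when ordered by inclusion. Given a collection $(T_j)_{j\in J}$ of sub-$\mathrm{Cu}$-semigroups of $S$, their supremum in this lattice is the sup-closure of the submonoid of $S$ generated by $\bigcup_{j\in J}T_j$, while their infimum is $\delta\big(\bigcap_{j\in J}T_j\big)$.
   Context: Way-below relation: in a partially ordered set, $x\ll y$ means that for every increasing sequence $(z_n)_n$ that has a supremum $z$ with $y\leq z$ there exists $n$ with $x\leq z_n$. A $\mathrm{Cu}$-semigroup is an abelian monoid $S$ with a partial order such that $0\leq x$ for all $x$, and $x\leq y$ implies $x+z\leq y+z$, satisfying: (O1) every increasing sequence has a supremum; (O2) every element is the supremum of a $\ll$-increasing sequence (i.e. $x_n\ll x_{n+1}$ for all $n$); (O3) $x'\ll x$ and $y'\ll y$ imply $x'+y'\ll x+y$; (O4) $\sup_n x_n+\sup_n y_n=\sup_n(x_n+y_n)$ for increasing sequences $(x_n)_n,(y_n)_n$. A $\mathrm{Cu}$-morphism is an order-preserving monoid morphism between $\mathrm{Cu}$-semigroups that preserves suprema of increasing sequences and the way-below relation. A submonoid $T\subseteq S$ is a sub-$\mathrm{Cu}$-semigroup if $T$ is a $\mathrm{Cu}$-semigroup with respect to the order induced by $S$ and the inclusion map $T\to S$ is a $\mathrm{Cu}$-morphism. Sup-closure: for a subset $T\subseteq S$ let $\overline{T}^{\mathrm{seq}}:=\{\sup_n x_n\in S : (x_n)_n \text{ increasing sequence in } T\}$. Define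 by transfinite induction $\overline{T}^{(0)}:=T$, $\overline{T}^{(\alpha+1)}:=\overline{\overline{T}^{(\alpha)}}^{\mathrm{seq}}$, and $\overline{T}^{(\lambda)}:=\bigcup_{\alpha<\lambda}\overline{T}^{(\alpha)}$ for limit ordinals $\lambda$. The sup-closure of $T$ is $\overline{T}^{\mathrm{sup}}:=\bigcup_{\alpha\geq1}\overline{T}^{(\alpha)}$. The operation $\delta$: for a subset $T\subseteq S$, set $T':=\{\sup_n x_n\in S : (x_n)_n \text{ is a } \ll\text{-increasing sequence in } T\}$, with $\ll$ and suprema taken in $S$. For a submonoid $T\subseteq S$ define by transfinite induction $T^{(0)}:=T$, $T^{(\alpha+1)}:=(T^{(\alpha)})'$, and $T^{(\lambda)}:=\bigcap_{\alpha<\lambda}T^{(\alpha)}$ for limit ordinals $\lambda$. Set $\delta(T):=\bigcap_{\alpha\geq1}T^{(\alpha)}$, the intersection being over all ordinals $\alpha\geq1$. *)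

(* Defs.v *)
From HB Require Import structures.
From mathcomp Require Import all_boot all_order.
From mathcomp Require Import boolp classical_sets wochoice.

Set Implicit Arguments.
Unset Strict Implicit.
Unset Printing Implicit Defensive.

Import Order.TTheory.
Local Open Scope classical_set_scope.
Local Open Scope order_scope.

Section OrderedSets.
Context {d : Order.disp_t} {S : porderType d}.
Implicit Types (x y z : S) (u : nat -> S).

Definition increasing u := forall m n : nat, (m <= n)%N -> u m <= u n.

(* [supremums] (from [classical_sets]) is the set of least upper bounds, which
   has at most one element. *)
Definition is_sup u z := supremums (range u) z.

Definition way_below x y :=
  forall u z, increasing u -> is_sup u z -> y <= z -> exists n, x <= u n.

Definition way_below_increasing u := forall n, way_below (u n) (u n.+1).

Definition complete_lattice :=
  forall A : set S, supremums A !=set0 /\ infimums A !=set0.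

End OrderedSets.
Arguments complete_lattice {d} S.

Notation "x ≪ y" := (way_below x y) (at level 70, no associativity).

(* The monoid operation is a [Monoid.com_law] on the carrier rather than an
   [nmodType] structure: MathComp has no join of [porderType] and [nmodType],
   and one cannot be declared on top of the existing [porderZmodType]. *)
Record CuSemigroup d (S : porderType d) (zero : S)
    (add : Monoid.com_law zero) : Prop := {
  Cu_ge0 : forall x, zero <= x;
  Cu_leD2r : forall x y z, x <= y -> add x z <= add y z;
  Cu_O1 : forall u : nat -> S, increasing u -> exists z, is_sup u z;
  Cu_O2 : forall x, exists2 u : nat -> S, way_below_increasing u & is_sup u x;
  Cu_O3 : forall x' x y' y, x' ≪ x -> y' ≪ y -> add x' y' ≪ add x y;
  Cu_O4 : forall (u v : nat -> S) x y, increasing u -> increasing v ->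
    is_sup u x -> is_sup v y -> is_sup (fun n => add (u n) (v n)) (add x y)
}.

Record CuMorphism d1 (S1 : porderType d1) (zero1 : S1)
    (add1 : Monoid.com_law zero1) d2 (S2 : porderType d2) (zero2 : S2)
    (add2 : Monoid.com_law zero2) (f : S1 -> S2) : Prop := {
  CuM_le : forall x y, x <= y -> f x <= f y;
  CuM_0 : f zero1 = zero2;
  CuM_D : forall x y, f (add1 x y) = add2 (f x) (f y);
  CuM_sup : forall (u : nat -> S1) z,
    increasing u -> is_sup u z -> is_sup (f \o u) (f z);
  CuM_way_below : forall x y, x ≪ y -> f x ≪ f y
}.

Section Submonoids.
Context {d : Order.disp_t} {S : porderType d} {zero : S}.
Variable add : Monoid.com_law zero.

Definition is_submonoid (M : set S) :=
  M zero /\ forall x y, M x -> M y -> M (add x y).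

Definition generated_submonoid (A : set S) : set S := smallest is_submonoid A.

Record submonoid := Submonoid {
  submonoid_set :> set S;
  submonoidP : is_submonoid submonoid_set
}.

Section Induced.
Variable M : submonoid.

(* [{x | x \in M}] carries the order induced by [S]. *)
Definition submonoid_type : Type := {x : S | x \in (M : set S)}.
HB.instance Definition _ := SubChoice.on submonoid_type.
HB.instance Definition _ := [SubChoice_isSubPOrder of submonoid_type by <:
  with d].

Lemma submonoid_memD (x y : submonoid_type) :
  add (val x) (val y) \in (M : set S).
Proof.
by rewrite inE; apply: (submonoidP M).2; apply/set_mem/valP.
Qed.

Definition sub_zero : submonoid_type := Sub zero (mem_set (submonoidP M).1).
Definition sub_add (x y : submonoid_type) : submonoid_type :=
  Sub (add (val x) (val y)) (submonoid_memD x y).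

Lemma sub_addA : associative sub_add.
Proof. by move=> x y z; apply: val_inj; rewrite /= Monoid.mulmA. Qed.
Lemma sub_addC : commutative sub_add.
Proof. by move=> x y; apply: val_inj; rewrite /= Monoid.mulmC. Qed.
Lemma sub_add0 : left_id sub_zero sub_add.
Proof. by move=> x; apply: val_inj; rewrite /= Monoid.mul1m. Qed.

HB.instance Definition _ := Monoid.isComLaw.Build submonoid_type sub_zero
  sub_add sub_addA sub_addC sub_add0.

End Induced.

Definition is_subCuSemigroup (M : submonoid) : Prop :=
  CuSemigroup (@sub_add M : Monoid.com_law (sub_zero M)) /\
  CuMorphism (@sub_add M : Monoid.com_law (sub_zero M)) add
    (val : submonoid_type M -> S).

Record subCuSemigroup := SubCuSemigroup {
  subCu_submonoid :> submonoid;
  subCuP : is_subCuSemigroup subCu_submonoid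
}.

HB.instance Definition _ := gen_eqMixin subCuSemigroup.
HB.instance Definition _ := gen_choiceMixin subCuSemigroup.

Definition subCu_le (T U : subCuSemigroup) := `[< T `<=` (U : set S) >].

Lemma subCu_le_refl : reflexive subCu_le.
Proof. by move=> T; apply/asboolP. Qed.
Lemma subCu_le_anti : antisymmetric subCu_le.
Proof.
move=> [[T hT] cT] [[U hU] cU] /andP[/asboolP /= TU /asboolP /= UT].
have eTU : T = U by apply/seteqP.
move: hT cT {TU UT}; rewrite eTU => hT.
by rewrite (Prop_irrelevance hT hU) => cT; rewrite (Prop_irrelevance cT cU).
Qed.
Lemma subCu_le_trans : transitive subCu_le.
Proof.
move=> U T V /asboolP TU /asboolP UV; apply/asboolP.
exact: subset_trans TU UV.
Qed.

HB.instance Definition _ := Order.Le_isPOrder.Build d subCuSemigroup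
  subCu_le_refl subCu_le_anti subCu_le_trans.

End Submonoids.

(* An ordinal is given as a point [a] of a well-ordered type; it stands for the
   order type of the set of points strictly below [a]. *)
Record Ord := Ord_at {
  ord_type : Type;
  ord_le : rel ord_type;
  ord_wo : well_order ord_le;
  ord_pt : ord_type
}.

Section Transfinite.
Context {W : Type} (R : rel W).

Definition ord_lt (x y : W) : Prop := ~~ R y x.
Definition is_zero (a : W) := forall b, ~ ord_lt b a.
Definition is_succ (b a : W) :=
  ord_lt b a /\ forall c, ord_lt c a -> ~ ord_lt b c.
Definition is_limit (a : W) := ~ is_zero a /\ forall b, ~ is_succ b a.

Hypothesis wo : well_order R.

Lemma ord_lt_wf : well_founded ord_lt.
Proof.
move=> a; apply: contrapT => na.
have [|m [[/asboolP nm mmin] _]] := wo (A := [pred x | `[< ~ Acc ord_lt x >]]).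
  by exists a; apply/asboolP.
apply: nm; constructor => b ltbm; apply: contrapT => nb.
by move/negP: ltbm; apply; apply: mmin; apply/asboolP.
Qed.

(* The transfinite iteration of [step] starting at [A0], in which [lim]
   combines the values at all smaller ordinals at limit stages.  Exactly one of
   the three clauses is nonvacuous, see [iterate_zero], [iterate_succ] and
   [iterate_limit]. *)
Context {X : Type} (A0 : set X) (step : set X -> set X)
  (lim : forall I : Type, (I -> set X) -> set X).

Definition iterate_body (a : W) (rec : forall b, ord_lt b a -> set X) : set X :=
  [set x | [/\ is_zero a -> A0 x,
      forall b (ltba : ord_lt b a), is_succ b a -> step (rec b ltba) x
    & is_limit a ->
      lim (fun b : {b : W | ord_lt b a} => rec (sval b) (svalP b)) x]].

Definition iterate_at : W -> set X := Fix ord_lt_wf (fun=> set X) iterate_body.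

Lemma iterate_atE a :
  iterate_at a = iterate_body (fun b (_ : ord_lt b a) => iterate_at b).
Proof.
rewrite /iterate_at Fix_eq// => b f g fg; congr iterate_body.
by apply: functional_extensionality_dep => c; apply: funext => h.
Qed.

Lemma ord_lt_tricho a b : [\/ ord_lt a b, a = b | ord_lt b a].
Proof.
have [Rab|] := boolP (R a b); last by constructor 3.
have [Rba|] := boolP (R b a); last by constructor 1.
constructor 2.
have [|m [_ um]] := wo (A := [pred x | `[< x = a \/ x = b >]]).
  by exists a; apply/asboolP; left.
have refl x : R x x.
  have [|y [[/asboolP -> my] _]] := wo (A := [pred y | `[< y = x >]]).
    by exists x; apply/asboolP.
  by apply: my; apply/asboolP.
rewrite -(um a) ?(um b)//; split; do ?by apply/asboolP; auto.
  by move=> x /asboolP[->|->].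
by move=> x /asboolP[->|->].
Qed.

Lemma iterate_zero a : is_zero a -> iterate_at a = A0.
Proof.
move=> a0; rewrite iterate_atE; apply/seteqP; split=> x.
  by case=> /(_ a0).
by move=> Ax; split=> // [b /a0|[]].
Qed.

Lemma iterate_succ b a : is_succ b a -> iterate_at a = step (iterate_at b).
Proof.
move=> ba; rewrite iterate_atE; apply/seteqP; split=> x.
  by case=> _ /(_ b ba.1 ba).
move=> sx; split=> [/(_ b)|c ltca ca|[_ /(_ b)]//].
  by case: ba => h _ /(_ h).
case: (ord_lt_tricho b c) => [bc|<-//|cb].
- by case: (ba.2 c ltca bc).
- by case: (ca.2 b ba.1 cb).
Qed.

Lemma iterate_limit a : is_limit a ->
  iterate_at a = lim (fun b : {b : W | ord_lt b a} => iterate_at (sval b)).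
Proof.
move=> la; rewrite iterate_atE; apply/seteqP; split=> x.
  by case=> _ _ /(_ la).
by move=> lx; split=> // [/la.1|b _ /la.2].
Qed.

End Transfinite.

Definition iterate {X : Type} (A0 : set X) (step : set X -> set X)
    (lim : forall I : Type, (I -> set X) -> set X) (a : Ord) : set X :=
  iterate_at (@ord_wo a) A0 step lim (ord_pt a).

Definition ord_ge1 (a : Ord) : Prop := ~ is_zero (@ord_le a) (ord_pt a).

(* Universe check: the well-orders in [Ord] include some on [set (set S)], so
   the transfinite iterations on [set S] below run long enough to stabilize.
   Unions and intersections over all of [Ord] are written with plain
   quantifiers: [\bigcup_(a : Ord) _] would place [Ord] strictly below the
   universe of [S]. *)
Lemma Ord_large d (S : porderType d) : exists a : Ord, ord_type a = set (set S).
Proof.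
have [R woR] := well_ordering_principle {classic set (set S)}.
by exists (@Ord_at (set (set S)) R woR set0).
Qed.

Section Closures.
Context {d : Order.disp_t} {S : porderType d}.
Implicit Type T : set S.

Definition seq_closure T : set S :=
  [set x | exists u, [/\ increasing u, forall n, T (u n) & is_sup u x]].

Definition sup_closure T : set S :=
  [set x | exists2 a, ord_ge1 a &
    iterate T seq_closure (fun I (F : I -> set S) => \bigcup_i F i) a x].

Definition derived T : set S :=
  [set x | exists u, [/\ way_below_increasing u, forall n, T (u n)
    & is_sup u x]].

Definition delta T : set S :=
  [set x | forall a, ord_ge1 a ->
    iterate T derived (fun I (F : I -> set S) => \bigcap_i F i) a x].

End Closures.

(* Main.v *)
Require Import Defs.
From HB Require Import structures.
From mathcomp Require Import all_boot all_order.
From mathcomp Require Import boolp classical_sets wochoice.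

(** Call a subset [T] of [S] closed if it contains the suprema of its increasing
    sequences, i.e. [seq_closure T `<=` T], and regular if each of its elements
    is the supremum of a ≪-increasing sequence in it, i.e. [T `<=` derived T].
    A submonoid is a sub-Cu-semigroup exactly when it is closed and regular
    ([subCu_seq_closed], [subCu_derived], [seq_closed_derived_subCu]): closed
    means that suprema of sequences are computed as in [S], and regularity then
    makes the two way-below relations agree.

    The transfinite constructions are least and greatest fixpoints.  Iterating
    a monotone operation that only decreases a set must become stationary, as
    otherwise the stages would inject a well-order on all families of subsets
    into the subsets; the stationary stage is the greatest set below the initial
    one that the operation does not shrink.  Applied to inclusion and to its
    converse, this says that [sup_closure T] is the least closed set containing
    [T] ([sup_closureP]), and that for a closed [T], [delta T] is the greatest
    regular subset of [T] ([deltaP]).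

    Supremum.  The least closed set [K] containing a submonoid is a submonoid,
    because translates pull closed sets back to closed sets by (O4).  It is
    regular when the submonoid is generated by sub-Cu-semigroups: [derived K] is
    a submonoid by (O3) and (O4), contains the generators, and is closed by a
    diagonal argument ([seq_closed_derived]), so it contains [K].  Every
    sub-Cu-semigroup containing the generators is closed, so it contains [K].

    Infimum.  The intersection [A] of sub-Cu-semigroups is a closed submonoid.
    Its greatest regular subset [D] is a submonoid, because sums of elements of
    [D] again form a regular subset of [A].  The sequential closure of [D] is
    contained in [derived D], hence regular, so maximality makes [D] closed.
    Every sub-Cu-semigroup contained in [A] is regular, so [D] contains it. *)

Local Open Scope classical_set_scope.

Set Implicit Arguments.
Unset Strict Implicit.
Unset Printing Implicit Defensive.

Import Order.TTheory.
Local Open Scope order_scope.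

(** * Increasing sequences and the way-below relation *)

Section WayBelow.
Context {d : Order.disp_t} {S : porderType d}.
Implicit Types (x y z : S) (u v : nat -> S) (T : set S).

Lemma is_supP u z :
  is_sup u z <-> (forall n, u n <= z) /\
                 (forall y, (forall n, u n <= y) -> z <= y).
Proof.
split=> [[ub lub]|[ub lub]].
  split=> [n|y uy]; first by apply: ub; exists n.
  by apply: lub => _ [n _ <-].
split=> [_ [n _ <-]//|y uy].
by apply: lub => n; apply: uy; exists n.
Qed.

Lemma is_sup_ub u z n : is_sup u z -> u n <= z.
Proof. by move=> /is_supP[]. Qed.

Lemma is_sup_le u z y : is_sup u z -> (forall n, u n <= y) -> z <= y.
Proof. by move=> /is_supP[_]; apply. Qed.

Lemma is_sup_unique u y z : is_sup u y -> is_sup u z -> y = z.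
Proof.
move=> uy uz; apply/le_anti/andP; split.
  by apply: is_sup_le uy _ => n; apply: is_sup_ub.
by apply: is_sup_le uz _ => n; apply: is_sup_ub.
Qed.

Lemma is_sup_cst x : is_sup (fun=> x) x.
Proof. by apply/is_supP; split=> // y /(_ 0). Qed.

Lemma way_below_le x y : x ≪ y -> x <= y.
Proof.
by move=> /(_ (fun=> y) y (fun _ _ _ => lexx y) (is_sup_cst y) (lexx y))[].
Qed.

Lemma le_way_below_trans x y z : x <= y -> y ≪ z -> x ≪ z.
Proof.
move=> xy yz u w uinc uw zw.
by have [n yn] := yz u w uinc uw zw; exists n; apply: le_trans yn.
Qed.

Lemma way_below_le_trans x y z : x ≪ y -> y <= z -> x ≪ z.
Proof.
by move=> xy yz u w uinc uw zw; apply: (xy u w) => //; apply: le_trans zw.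
Qed.

Lemma way_below_inc u : way_below_increasing u -> increasing u.
Proof.
move=> uwb m n /subnK <-; elim: (n - m)%N => [|k ih]; first by rewrite add0n.
by apply: le_trans ih _; rewrite addSn; apply: way_below_le.
Qed.

Lemma way_below_increasing_lt u m n :
  way_below_increasing u -> (m < n)%N -> u m ≪ u n.
Proof.
by move=> uwb mn; apply: way_below_le_trans (uwb m) (way_below_inc uwb mn).
Qed.

Lemma way_below_increasing_sup u x n :
  way_below_increasing u -> is_sup u x -> u n ≪ x.
Proof. by move=> uwb ux; apply: way_below_le_trans (uwb n) (is_sup_ub _ ux). Qed.

Lemma sub_seq_closure T : T `<=` seq_closure T.
Proof. by move=> x Tx; exists (fun=> x); split=> //; apply: is_sup_cst. Qed.

Lemma seq_closureS T T' : T `<=` T' -> seq_closure T `<=` seq_closure T'.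
Proof. by move=> TT' x [u [uinc Tu ux]]; exists u; split=> // n; apply: TT'. Qed.

Lemma derivedS T T' : T `<=` T' -> derived T `<=` derived T'.
Proof. by move=> TT' x [u [uwb Tu ux]]; exists u; split=> // n; apply: TT'. Qed.

Lemma derived_seq_closure T : derived T `<=` seq_closure T.
Proof.
by move=> x [u [uwb Tu ux]]; exists u; split=> //; apply: way_below_inc.
Qed.

(** If [x] is the supremum of [u], and [u k] that of the ≪-increasing sequence
    [v k], then passing to subsequences [w k] of the [v k] makes [w k n]
    increasing in [k] as well; the diagonal [w n n] is then ≪-increasing and
    cofinal among all the [v k n], so that its supremum is [x]. *)
Lemma seq_closed_derived T : seq_closure (derived T) `<=` derived T.
Proof.
move=> x [u [uinc Tu ux]].
have [v vP] := choice Tu.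
have vwb k : way_below_increasing (v k) by case: (vP k).
have vu k : is_sup (v k) (u k) by case: (vP k).
have vnext k m : exists e, v k m <= v k.+1 e.
  apply: (way_below_increasing_sup m (vwb k) (vu k) _ (vu k.+1)).
    exact: way_below_inc.
  exact: uinc.
have [e eP] := choice (fun p : nat * nat => vnext p.1 p.2).
(* The [k]-th subsequence is [v k \o g k].  Summing makes [g k.+1] strictly
   increasing while keeping [g k.+1 n] above [e (k, g k n)]. *)
pose fix g k := if k isn't k'.+1 then id else
  fun n => (\sum_(i < n.+1) (e (k', g k' i)).+1)%N.
have g_lt k n : (g k n < g k n.+1)%N.
  by case: k => [|k]//=; rewrite [ltnRHS]big_ord_recr/= addnS ltnS leq_addr.
have g_ge k n : (n <= g k n)%N.
  by elim: n => // n ih; apply: leq_ltn_trans (g_lt k n).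
pose w k n := v k (g k n).
have wwb k : way_below_increasing (w k).
  by move=> n; apply: way_below_increasing_lt (vwb k) (g_lt k n).
have w_next k n : w k n <= w k.+1 n.
  apply: le_trans (eP (k, g k n)) _ => /=; apply: way_below_inc => //=.
  by rewrite big_ord_recr/= addnS; apply/leqW/leq_addl.
have w_le n : {homo w^~ n : k l / (k <= l)%N >-> k <= l}.
  move=> k l /= /subnK <-; elim: (l - k)%N => [|m ih]; first by rewrite add0n.
  by apply: le_trans ih _; rewrite addSn.
exists (fun n => w n n); split.
- by move=> n; apply: le_way_below_trans (w_next n n) (wwb n.+1 n).
- by move=> n; have [_ vT _] := vP n; apply: vT.
- apply/is_supP; split=> [n|y wy].
    exact: le_trans (is_sup_ub _ (vu n)) (is_sup_ub _ ux).
  apply: is_sup_le ux _ => k; apply: is_sup_le (vu k) _ => n.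
  apply: le_trans (wy (maxn k n)).
  apply: le_trans (w_le _ _ _ (leq_maxl k n)).
  by apply: way_below_inc => //; apply: leq_trans (leq_maxr k n) (g_ge _ _).
Qed.

End WayBelow.

(** * Transfinite iteration of a monotone operation *)

Lemma Cantor_set (X : Type) (f : set X -> X) : ~ injective f.
Proof.
move=> finj; pose D := [set x | exists2 A, x = f A & ~ A x].
have [Df|nDf] := pselect (D (f D)); last by apply/nDf; exists D.
by case: (Df) => A /finj <-.
Qed.

(** The hypothesis [I] in the last premise reflects that a limit ordinal has
    predecessors: without it, a [P] that fails for an empty union or
    intersection would be out of reach. *)
Lemma iterate_ind (X : Type) (A0 : set X) (step : set X -> set X)
    (lim : forall I : Type, (I -> set X) -> set X) (P : set X -> Prop) :
  P A0 -> (forall A, P A -> P (step A)) ->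
  (forall I (F : I -> set X), I -> (forall i, P (F i)) -> P (lim I F)) ->
  forall a, P (iterate A0 step lim a).
Proof.
move=> P0 Pstep Plim [W R wo a]; rewrite /iterate/=.
elim/(well_founded_ind (ord_lt_wf wo)): a => a ih.
have [a0|na0] := pselect (is_zero R a); first by rewrite iterate_zero.
have [[b ba]|nsucc] := pselect (exists b, is_succ R b a).
  by rewrite (iterate_succ _ _ _ _ ba); apply/Pstep/ih/ba.1.
rewrite iterate_limit; last by split=> // b ba; apply: nsucc; exists b.
have /existsNP[b /contrapT ba] := na0.
by apply: Plim => [|[c ca]]; [exact: (exist _ b ba)|exact: ih].
Qed.

(** The relation [le] is a parameter so that one development covers decreasing
    iterations ([le] inclusion, [lim] intersection) and increasing ones ([le]
    reverse inclusion, [lim] union). *)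
Section GreatestPostfixpoint.
Context {X : Type} (le : set X -> set X -> Prop).
Context (A0 : set X) (step : set X -> set X).
Context (lim : forall I : Type, (I -> set X) -> set X).
Hypothesis le_refl : forall A, le A A.
Hypothesis le_trans : forall B A C, le A B -> le B C -> le A C.
Hypothesis lim_lb : forall I (F : I -> set X) i, le (lim F) (F i).
Hypothesis lim_glb :
  forall I (F : I -> set X) C, (forall i, le C (F i)) -> le C (lim F).
Hypothesis step_mono : forall A B, le A B -> le (step A) (step B).
Hypothesis step_A0 : le (step A0) A0.

Let it := iterate A0 step lim.

Lemma iterate_le a : le (it a) A0.
Proof.
apply: (iterate_ind (P := fun A => le A A0)) => // [A AA0|I F i FA0].
  exact: le_trans (step_mono AA0) step_A0.
exact: le_trans (lim_lb F i) (FA0 i).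
Qed.

Lemma iterate_prefixed a : le (step (it a)) (it a).
Proof.
apply: (iterate_ind (P := fun A => le (step A) A)) => // [A|I F _ stepF].
  exact: step_mono.
by apply: lim_glb => i; apply: le_trans (stepF i); apply/step_mono/lim_lb.
Qed.

Lemma postfixed_le_iterate C a : le C A0 -> le C (step C) -> le C (it a).
Proof.
move=> CA0 Cstep; apply: (iterate_ind (P := le C)) => // [A CA|I F _];
  last exact: lim_glb.
exact: le_trans Cstep (step_mono CA).
Qed.

(** Each stage lies below the successor of every earlier stage, even if that
    successor is not represented by a point of [W]. *)
Lemma iterate_le_step W (R : rel W) (wo : well_order R) a b :
  ord_lt R b a -> le (it (Ord_at wo a)) (step (it (Ord_at wo b))).
Proof.
elim/(well_founded_ind (ord_lt_wf wo)): a b => a ih b ba.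
have ih' c : ord_lt R c a -> ord_lt R b c ->
    le (it (Ord_at wo c)) (step (it (Ord_at wo b))) by move=> ca; exact: ih.
rewrite {1}/it /iterate/=.
have [[c ca]|nsucc] := pselect (exists c, is_succ R c a).
  rewrite (iterate_succ _ _ _ _ ca); apply: step_mono.
  case: (ord_lt_tricho wo b c) => [bc|->//|cb]; last by case: (ca.2 b ba).
  exact: le_trans (ih' c ca.1 bc) (iterate_prefixed _).
rewrite iterate_limit; last first.
  by split=> [/(_ b ba)//|c ca]; apply: nsucc; exists c.
(* [a] is not the successor of [b], so some point lies strictly between. *)
have [c [ca bc]] : exists c, ord_lt R c a /\ ord_lt R b c.
  apply: contrapT => nc; apply: nsucc; exists b; split=> // c ca bc.
  by apply: nc; exists c.
exact: le_trans (lim_lb _ (exist _ c ca)) (ih' c ca bc).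
Qed.

(** If two stages [b < a] coincide, then stage [b] is below its own image.  So if
    no stage were, the stages along a well-order on [set (set X)] would be an
    injection of [set (set X)] into [set X]. *)
Lemma iterate_stationary :
  exists2 a, ord_ge1 a & le (it a) (step (it a)).
Proof.
have [R wo] := well_ordering_principle {classic set (set X)}.
have [a aP] : exists a, le (it (Ord_at wo a)) (step (it (Ord_at wo a))).
  apply: contrapT => nstat; apply: (@Cantor_set (set X) (it \o Ord_at wo)).
  move=> a b /= eab; case: (ord_lt_tricho wo a b) => [ab|//|ba];
    exfalso; apply: nstat.
    by exists a; rewrite {1}eab; apply: iterate_le_step.
  by exists b; rewrite -{1}eab; apply: iterate_le_step.
(* If the stage found is [A0] itself, then all stages are equivalent, and any
   other point of the well-order provides a stage of index at least 1. *)
have [a0|] := pselect (is_zero R a); last by exists (Ord_at wo a).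
have [c ac] : exists c, c <> a.
  apply: contrapT => nc.
  have eqa c : c = a by apply: contrapT => ca; apply: nc; exists c.
  have : [set: set X] = set0 :> set (set X) by rewrite [LHS]eqa [RHS]eqa.
  by move=> /seteqP[/(_ set0 I)].
exists (Ord_at wo c).
  move=> c0; case: (ord_lt_tricho wo a c) => [|/esym//|].
    exact: c0.
  exact: a0.
have eA0 : it (Ord_at wo a) = A0 by rewrite /it /iterate iterate_zero.
rewrite eA0 in aP.
apply: le_trans (iterate_le _) (le_trans aP (step_mono _)).
exact: postfixed_le_iterate.
Qed.

End GreatestPostfixpoint.

Section ClosureFixpoints.
Context {d : Order.disp_t} {S : porderType d}.
Implicit Types T C : set S.

(** Under reverse inclusion, [T] is the top element and a set is below its image
    exactly when it is closed, so the stationary stage is the least closed set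
    containing [T]. *)
Lemma sup_closureP T :
  [/\ T `<=` sup_closure T,
      seq_closure (sup_closure T) `<=` sup_closure T
    & forall C, T `<=` C -> seq_closure C `<=` C -> sup_closure T `<=` C].
Proof.
pose ge (A B : set S) := B `<=` A.
pose lim I (F : I -> set S) := \bigcup_i F i.
have ge_refl A : ge A A by [].
have ge_trans B A C : ge A B -> ge B C -> ge A C.
  by move=> AB BC; apply: subset_trans BC AB.
have lim_lb I (F : I -> set S) i : ge (lim I F) (F i) by apply: bigcup_sup.
have lim_glb I (F : I -> set S) C : (forall i, ge C (F i)) -> ge C (lim I F).
  by move=> CF; apply: bigcup_sub => i _; apply: CF.
have mono A B : ge A B -> ge (seq_closure A) (seq_closure B).
  exact: seq_closureS.
have least C a : T `<=` C -> seq_closure C `<=` C ->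
    iterate T (@seq_closure _ S) lim a `<=` C.
  exact: (postfixed_le_iterate ge_trans lim_glb mono).
have [a a1 aP] := iterate_stationary ge_refl ge_trans lim_lb
  lim_glb mono (@sub_seq_closure _ _ T).
have T_le b := iterate_le ge_refl ge_trans lim_lb mono
  (@sub_seq_closure _ _ T) b.
have -> : sup_closure T = iterate T (@seq_closure _ S) lim a.
  apply/seteqP; split=> x; last by exists a.
  by case=> b _; apply: least => //; apply: T_le.
by split; [exact: T_le|exact: aP|move=> C TC CC; apply: least].
Qed.

(** Closedness of [T] guarantees that the first step, hence every step, of the
    iteration is decreasing. *)
Lemma deltaP T : seq_closure T `<=` T ->
  [/\ delta T `<=` T, delta T `<=` derived (delta T)
    & forall C, C `<=` T -> C `<=` derived C -> C `<=` delta T].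
Proof.
move=> Tseq; pose le (A B : set S) := A `<=` B.
pose lim I (F : I -> set S) := \bigcap_i F i.
have T'T : le (derived T) T := subset_trans (@derived_seq_closure _ _ T) Tseq.
have le_refl A : le A A by [].
have le_trans B A C : le A B -> le B C -> le A C by apply: subset_trans.
have lim_lb I (F : I -> set S) i : le (lim I F) (F i) by apply: bigcap_inf.
have lim_glb I (F : I -> set S) C : (forall i, le C (F i)) -> le C (lim I F).
  by move=> CF; apply: sub_bigcap => i _; apply: CF.
have mono A B : le A B -> le (derived A) (derived B) by apply: derivedS.
have greatest C a : C `<=` T -> C `<=` derived C ->
    C `<=` iterate T (@derived _ S) lim a.
  exact: (postfixed_le_iterate le_trans lim_glb mono).
have [a a1 aP] := iterate_stationary le_refl le_trans lim_lb
  lim_glb mono T'T.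
have le_T b := iterate_le le_refl le_trans lim_lb mono T'T b.
have -> : delta T = iterate T (@derived _ S) lim a.
  apply/seteqP; split=> x; first exact.
  by move=> ax b _; apply: (greatest _ b _ aP) => //; apply: le_T.
by split; [exact: le_T|exact: aP|move=> C CT CC; apply: greatest].
Qed.

End ClosureFixpoints.

(** * Sub-Cu-semigroups *)

Section SubCu.
Context {d : Order.disp_t} {S : porderType d} {zero : S}.
Variables (add : Monoid.com_law zero) (CuS : CuSemigroup add).
Implicit Types (M : submonoid add) (C E T : set S).

Lemma sub_increasing M (u : nat -> submonoid_type M) :
  increasing u <-> increasing (val \o u).
Proof. by split=> uinc m n mn; move: (uinc m n mn); rewrite leEsub. Qed.

Lemma is_sup_sub M (u : nat -> submonoid_type M) z :
  is_sup (val \o u) (val z) -> is_sup u z.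
Proof.
move=> /is_supP[ub lub]; apply/is_supP; split=> [n|y uy]; rewrite leEsub.
  exact: ub.
by apply: lub => n; move: (uy n); rewrite leEsub.
Qed.

Section SeqClosed.
Variable M : submonoid add.
Hypothesis Mseq : seq_closure M `<=` M.

Lemma sub_has_sup (u : nat -> submonoid_type M) : increasing u ->
  exists2 z, is_sup u z & is_sup (val \o u) (val z).
Proof.
move=> /sub_increasing uinc; have [z uz] := Cu_O1 CuS uinc.
have Mz : z \in (M : set S).
  apply/mem_set/Mseq; exists (val \o u); split=> // n.
  exact/set_mem/valP.
by exists (Sub z Mz) => //; apply: is_sup_sub.
Qed.

Lemma is_sup_val (u : nat -> submonoid_type M) z : increasing u ->
  is_sup u z -> is_sup (val \o u) (val z).
Proof.
by move=> uinc uz; have [y uy] := sub_has_sup uinc; rewrite (is_sup_unique uz uy).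
Qed.

Lemma way_below_sub (x y : submonoid_type M) : val x ≪ val y -> x ≪ y.
Proof.
move=> xy u z uinc uz yz.
have [n xn] := xy _ _ (proj1 (sub_increasing u) uinc) (is_sup_val uinc uz) yz.
by exists n; rewrite leEsub.
Qed.

Hypothesis Mder : M `<=` derived M.

Lemma derived_sub (x : submonoid_type M) : exists u : nat -> submonoid_type M,
  way_below_increasing (val \o u) /\ is_sup (val \o u) (val x).
Proof.
have [u [uwb Mu ux]] := Mder (set_mem (valP x)).
by exists (fun n => Sub (u n) (mem_set (Mu n))).
Qed.

(** This is where regularity enters: [x ≪ y] in [M] puts [x] below some term of a
    sequence of [M] that is ≪-increasing in [S] with supremum [y]. *)
Lemma way_below_val (x y : submonoid_type M) : x ≪ y -> val x ≪ val y.
Proof.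
move=> xy; have [u [uwb uy]] := derived_sub y.
have [n] := xy u y (proj2 (sub_increasing u) (way_below_inc uwb))
  (is_sup_sub uy) (lexx y).
rewrite leEsub => xn.
exact: le_way_below_trans xn (way_below_increasing_sup n uwb uy).
Qed.

Lemma seq_closed_derived_subCu : is_subCuSemigroup M.
Proof.
split; split.
- by move=> x; rewrite leEsub; apply: (Cu_ge0 CuS).
- by move=> x y z; rewrite !leEsub; apply: (Cu_leD2r CuS).
- by move=> u /sub_has_sup[z]; exists z.
- move=> x; have [u [uwb ux]] := derived_sub x; exists u.
    by move=> n; apply/way_below_sub/uwb.
  exact: is_sup_sub.
- move=> x' x y' y /way_below_val x'x /way_below_val y'y.
  by apply: way_below_sub; apply: (Cu_O3 CuS).
- move=> u v x y uinc vinc /(is_sup_val uinc) ux /(is_sup_val vinc) vy.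
  apply: is_sup_sub; apply: (Cu_O4 CuS _ _ ux vy); exact/sub_increasing.
- by move=> x y; rewrite leEsub.
- by [].
- by [].
- exact: is_sup_val.
- exact: way_below_val.
Qed.

End SeqClosed.

(** The supremum taken in [U] exists by (O1), and the inclusion, being a
    Cu-morphism, maps it to the supremum in [S]. *)
Lemma subCu_seq_closed (U : subCuSemigroup add) : seq_closure U `<=` U.
Proof.
have [CuU incl] := subCuP U.
move=> x [u [uinc Uu ux]].
pose v n : submonoid_type U := Sub (u n) (mem_set (Uu n)).
have vinc : increasing v by apply/sub_increasing.
have [z vz] := Cu_O1 CuU vinc.
have -> : x = val z := is_sup_unique ux (CuM_sup incl vinc vz).
exact/set_mem/valP.
Qed.

Lemma subCu_derived (U : subCuSemigroup add) : U `<=` derived U.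
Proof.
have [CuU incl] := subCuP U.
move=> x Ux; have [u uwb ux] := Cu_O2 CuU (Sub x (mem_set Ux)).
exists (val \o u); split=> [n|n|].
- exact: (CuM_way_below incl).
- exact/set_mem/valP.
- exact: (CuM_sup incl (way_below_inc uwb) ux).
Qed.

Lemma zero_way_below x : zero ≪ x.
Proof. by move=> u z _ _ _; exists 0; apply: (Cu_ge0 CuS). Qed.

Lemma derivedD C E x y : derived C x -> derived E y ->
  derived [set add p q | p in C & q in E] (add x y).
Proof.
move=> [u [uwb Cu ux]] [v [vwb Ev vy]].
exists (fun n => add (u n) (v n)); split=> [n|n|].
- exact: (Cu_O3 CuS (uwb n) (vwb n)).
- by exists (u n) => //; exists (v n).
- exact: (Cu_O4 CuS (way_below_inc uwb) (way_below_inc vwb) ux vy).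
Qed.

Lemma derived_zero C : C zero -> derived C zero.
Proof.
move=> C0; exists (fun=> zero); split=> // [n|]; first exact: zero_way_below.
exact: is_sup_cst.
Qed.

Lemma derived_submonoid C : is_submonoid add C -> is_submonoid add (derived C).
Proof.
move=> [C0 CD]; split=> [|x y Cx Cy]; first exact: derived_zero.
apply: derivedS (derivedD Cx Cy) => _ [p Cp [q Cq <-]].
exact: CD.
Qed.

(** Minimality of [K := sup_closure M] is used once for each summand: for [y] in
    [M], the [x] with [add x y] in [K] form a closed set containing [M], hence
    all of [K]; for [x] in [K], the [y] with [add x y] in [K] then do so too. *)
Lemma sup_closure_submonoid M : is_submonoid add (sup_closure M).
Proof.
have [MK Kseq Kleast] := sup_closureP M.
set K := sup_closure M in MK Kseq Kleast *.
have translate_closed y : seq_closure [set x | K (add x y)] `<=`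
    [set x | K (add x y)].
  move=> x [u [uinc Ku ux]]; apply: Kseq; exists (fun n => add (u n) y).
  split=> // [m n mn|]; first exact/(Cu_leD2r CuS)/uinc.
  exact: (Cu_O4 CuS uinc _ ux (is_sup_cst y)).
have KM x y : K x -> (M : set S) y -> K (add x y).
  move=> Kx My; apply: (Kleast _ _ (translate_closed y) x Kx) => z Mz /=.
  exact/MK/(submonoidP M).2.
split=> [|x y Kx Ky]; first exact/MK/(submonoidP M).1.
rewrite Monoid.mulmC; apply: (Kleast _ _ (translate_closed x) y Ky) => z Mz /=.
by rewrite Monoid.mulmC; apply: KM.
Qed.

(** [set zero] and the set of sums of elements of [delta M] are regular subsets
    of [M], so maximality places them inside [delta M]. *)
Lemma delta_submonoid M : seq_closure M `<=` M -> is_submonoid add (delta M).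
Proof.
move=> /deltaP[DM DD Dmax]; split=> [|x y Dx Dy].
  apply: (Dmax [set zero]) => [_ ->|_ ->|//]; first exact: (submonoidP M).1.
  exact: derived_zero.
apply: (Dmax [set add p q | p in delta M & q in delta M]).
- by move=> _ [p Dp [q Dq <-]]; apply: (submonoidP M).2; apply: DM.
- by move=> _ [p Dp [q Dq <-]]; apply: derivedD; apply: DD.
- by exists x => //; exists y.
Qed.

Lemma subCu_leP (T U : subCuSemigroup add) : T <= U <-> T `<=` (U : set S).
Proof. by split=> /asboolP. Qed.

Lemma generated_submonoidP (A : set S) :
  is_submonoid add (generated_submonoid add A).
Proof.
split=> [C [[C0 _] _]//|x y Ax Ay C CP].
by apply: CP.1.2; [apply: Ax|apply: Ay].
Qed.

Lemma subCu_sup (J : Type) (T : J -> subCuSemigroup add) :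
  exists2 U : subCuSemigroup add, supremums (range T) U &
    (U : set S) =
      sup_closure (generated_submonoid add (\bigcup_j (T j : set S))).
Proof.
set A := \bigcup_j _; pose M := Submonoid (generated_submonoidP A).
have [MK Kseq Kleast] := sup_closureP M.
pose K := Submonoid (sup_closure_submonoid M).
have AK : A `<=` K.
  by apply: subset_trans MK => x Ax C [_]; apply.
have Kder : K `<=` derived K.
  apply: Kleast (@seq_closed_derived _ _ _) => x; apply; split.
    exact/derived_submonoid/submonoidP.
  move=> y [j _ Ty]; apply: derivedS (subCu_derived Ty) => z Tz.
  by apply: AK; exists j.
exists (SubCuSemigroup (@seq_closed_derived_subCu K Kseq Kder)) => //.
split=> [_ [j _ <-]|U TU]; apply/subCu_leP => /=.
  by move=> x Tx; apply: AK; exists j.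
apply: Kleast (@subCu_seq_closed U) => x; apply; split; first exact: submonoidP.
move=> y [j _ Ty]; have /subCu_leP : T j <= U by apply: TU; exists j.
exact.
Qed.

Lemma subCu_inf (J : Type) (T : J -> subCuSemigroup add) :
  exists2 U : subCuSemigroup add, infimums (range T) U &
    (U : set S) = delta (\bigcap_j (T j : set S)).
Proof.
set A := \bigcap_j _.
have Asub : is_submonoid add A.
  split=> [j _|x y Ax Ay j _]; first exact: (submonoidP (T j)).1.
  by apply: (submonoidP (T j)).2; [apply: Ax|apply: Ay].
have Aseq : seq_closure A `<=` A.
  move=> x Ax j _; apply: subCu_seq_closed; apply: seq_closureS x Ax => x.
  exact.
have [DA Dder Dmax] := deltaP Aseq.
pose D := Submonoid (@delta_submonoid (Submonoid Asub) Aseq).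
have Dseq : seq_closure D `<=` D.
  apply: Dmax => [x|].
    by move=> Dx; apply/Aseq/(seq_closureS DA).
  move=> x Dx; apply: derivedS (@sub_seq_closure _ _ D) _ _.
  by apply: seq_closed_derived; apply: seq_closureS Dder _ Dx.
exists (SubCuSemigroup (@seq_closed_derived_subCu D Dseq Dder)) => //.
split=> [_ [j _ <-]|U UT]; apply/subCu_leP => /=.
  by move=> x /DA; apply.
apply: Dmax (@subCu_derived U) => x Ux j _.
have /subCu_leP UTj : U <= T j by apply: UT; exists j.
exact: UTj.
Qed.

End SubCu.

Theorem theorem4p15 (d : Order.disp_t) (S : porderType d) (zero : S)
    (add : Monoid.com_law zero) (CuS : CuSemigroup add) :
  complete_lattice (subCuSemigroup add) /\
  forall (J : Type) (T : J -> subCuSemigroup add),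
    (exists2 U : subCuSemigroup add, supremums (range T) U &
       (U : set S) =
         sup_closure (generated_submonoid add (\bigcup_j (T j : set S)))) /\
    (exists2 U : subCuSemigroup add, infimums (range T) U &
       (U : set S) = delta (\bigcap_j (T j : set S))).
Proof.
split=> [A|J T]; last by split; [apply: subCu_sup|apply: subCu_inf].
(* A set of sub-Cu-semigroups is the range of the family that it indexes. *)
have <- : range (sval : {T | A T} -> subCuSemigroup add) = A.
  apply/seteqP; split=> [_ [[T AT] _ <-]//|T AT].
  by exists (exist _ T AT).
split; first by have [U] := subCu_sup CuS (sval : {T | A T} -> _); exists U.
by have [U] := subCu_inf CuS (sval : {T | A T} -> _); exists U.
Qed.
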